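(* Let $(N,[\cdot,\ldots,\cdot],\alpha)$ be a multiplicative $n$-ary Hom-Nambu superalgebra such that $\alpha=0$. If the bracket $[\cdot,\ldots,\cdot]\colon N^n\to N$ is surjective, then $$\operatorname{Der}_{\alpha^{k+1}}(N)=\operatorname{Inn}_{\alpha^k}(N)=\{0\}$$ for every integer $k\ge 0$. Consequently, $N$ is complete if and only if $C(N)=\{0\}$.
   Context: Vector spaces are over a field $\mathbb{K}$ of characteristic zero, and $n\ge 2$. $N=N_{\bar 0}\oplus N_{\bar 1}$ is $\mathbb{Z}_2$-graded; $H(N)=N_{\bar 0}\cup N_{\bar 1}$ is the set of homogeneous elements and $|x|$ is the parity of $x\in H(N)$. A linear map is even if it preserves the grading; an $n$-linear bracket is even if $[N_{\bar k_1},\ldots,N_{\bar k_n}]\subseteq N_{\bar k_1+\cdots+\bar k_n}$. A multiplicative $n$-ary Hom-Nambu superalgebra $(N,[\cdot,\ldots,\cdot],\alpha)$ consists of such an $N$, an even $n$-linear bracket and an even linear map $\alpha:N\to N$ with $\alpha([x_1,\ldots,x_n])=[\alpha(x_1),\ldots,\alpha(x_n)]$ for all $x_i\in N$, satisfying for homogeneous $x_i,y_j$ the super-Hom-Nambu identity $$[\alpha(x_1),\ldots,\alpha(x_{n-1}),[y_1,\ldots,y_n]]=\sum_{i=1}^n(-1)^{|X||Y|_{i-1}}[\alpha(y_1),\ldots,\alpha(y_{i-1}),[x_1,\ldots,x_{n-1},y_i],\alpha(y_{i+1}),\ldots,\alpha(y_n)],$$ where $|X|=\sum_{k=1}^{n-1}|x_k|$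 and $|Y|_{i-1}=\sum_{k=1}^{i-1}|y_k|$. No skew-symmetry is assumed. With $\alpha^0=\mathrm{id}$, a homogeneous linear map $D:N\to N$ of parity $|D|$ is an $\alpha^k$-derivation if $D\circ\alpha=\alpha\circ D$ and, for homogeneous $x_i$, $$D([x_1,\ldots,x_n])=\sum_{i=1}^n(-1)^{|D|(|x_1|+\cdots+|x_{i-1}|)}[\alpha^k(x_1),\ldots,\alpha^k(x_{i-1}),D(x_i),\alpha^k(x_{i+1}),\ldots,\alpha^k(x_n)].$$ $\operatorname{Der}_{\alpha^k}(N)$ is the direct sum of the spaces of even and of odd $\alpha^k$-derivations. For $X=(x_1,\ldots,x_{n-1})\in H(N)^{n-1}$ with $\alpha(x_i)=x_i$ for all $i$, set $\operatorname{ad}_X^k(y)=[x_1,\ldots,x_{n-1},\alpha^k(y)]$; this is an $\alpha^{k+1}$-derivation, called inner. $\operatorname{Inn}_{\alpha^k}(N)\subseteq\operatorname{Der}_{\alpha^{k+1}}(N)$ is the linear span of all such $\operatorname{ad}_X^k$. The $i$-th positional center is $C_i(N)=\{z\in N: [x_1,\ldots,x_{i-1},z,x_{i+1},\ldots,x_n]=0\ \text{for all } x_j\in N\}$, and the center is $C(N)=\bigcap_{i=1}^nC_i(N)$. $N$ is complete if $C(N)=\{0\}$ and $\operatorname{Der}_{\alpha^{k+1}}(N)=\operatorname{Inn}_{\alpha^k}(N)$ for every integer $k\ge 0$. *)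

(* Defs.v *)
From mathcomp Require Import all_boot all_order all_algebra.
From mathcomp Require Import boolp classical_sets functions.
Set Implicit Arguments.
Unset Strict Implicit.
Unset Printing Implicit Defensive.
Import GRing.Theory.
Local Open Scope classical_set_scope.
Local Open Scope ring_scope.

(* (x_1, ..., x_(n-1), y); meant for n >= 1. *)
Definition append_last (T : Type) (n : nat) (x : 'I_n.-1 -> T) (y : T) :
    'I_n -> T :=
  fun i => oapp x y (insub (i : nat) : option 'I_n.-1).

Definition replace (T : Type) (n : nat) (x : 'I_n -> T) (i : 'I_n) (z : T) :
    'I_n -> T :=
  @dfwith _ (fun=> T) x i z.

Definition multilinear (K : fieldType) (V W : lmodType K) (n : nat)
    (f : ('I_n -> V) -> W) : Prop :=
  forall (x : 'I_n -> V) (i : 'I_n), linear (fun z => f (replace x i z)).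

(* The set of finite linear combinations of elements of [S]. *)
Definition lspan (K : fieldType) (V : lmodType K) (S : set V) : set V :=
  [set v | exists (m : nat) (c : 'I_m -> K) (s : 'I_m -> V),
     (forall i, S (s i)) /\ v = \sum_(i < m) c i *: s i].

(* Parities are booleans ([true] is odd), with [addb] as the addition of Z/2.
   The zero vector belongs to both [grade false] and [grade true]; in the
   identities below every term then vanishes, so its parity is irrelevant. *)
Record homNambuSuperalgebra (K : fieldType) (n : nat) := HomNambuSuperalgebra {
  carrier :> lmodType K;
  grade : bool -> {pred carrier};
  grade_submod : forall p, submod_closed (grade p);
  grade_span : forall z, exists z0 z1,
    [/\ z0 \in grade false, z1 \in grade true & z = z0 + z1];
  grade_disjoint : forall z, z \in grade false -> z \in grade true -> z = 0;
  bracket : ('I_n -> carrier) -> carrier;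
  bracket_multilinear : multilinear bracket;
  bracket_even : forall (p : 'I_n -> bool) (x : 'I_n -> carrier),
    (forall i, x i \in grade (p i)) ->
    bracket x \in grade (\big[addb/false]_(i < n) p i);
  alpha : {linear carrier -> carrier};
  alpha_even : forall p z, z \in grade p -> alpha z \in grade p;
  alpha_bracket : forall x : 'I_n -> carrier,
    alpha (bracket x) = bracket (alpha \o x);
  hom_nambu : forall (p : 'I_n.-1 -> bool) (q : 'I_n -> bool)
      (x : 'I_n.-1 -> carrier) (y : 'I_n -> carrier),
    (forall k, x k \in grade (p k)) -> (forall i, y i \in grade (q i)) ->
    bracket (append_last (alpha \o x) (bracket y)) =
    \sum_(i < n)
      (-1) ^+ ((\sum_(k < n.-1) p k) * (\sum_(k < n | (k < i)%N) q k))%N *: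
      bracket (replace (alpha \o y) i (bracket (append_last x (y i))))
}.

Arguments grade {K n} _ _.
Arguments bracket {K n} _ _.
Arguments alpha {K n} _.

Section HomNambuSuperalgebra.
Variables (K : fieldType) (n : nat) (N : homNambuSuperalgebra K n).

Definition homogeneous (z : N) : Prop := exists p, z \in grade N p.

(* The homogeneous alpha^k-derivations of parity [d]. *)
Definition homogeneous_derivation (k : nat) (d : bool) : set (N -> N) :=
  [set D | [/\ linear D,
    (forall p z, z \in grade N p -> D z \in grade N (d (+) p)),
    D \o alpha N = alpha N \o D &
    forall (p : 'I_n -> bool) (x : 'I_n -> N),
      (forall i, x i \in grade N (p i)) ->
      D (bracket N x) =
      \sum_(i < n) (-1) ^+ (d * \sum_(j < n | (j < i)%N) p j)%N *:
        bracket N (replace (iter k (alpha N) \o x) i (D (x i)))]].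

(* The sum is direct: a map which is both even and odd sends each homogeneous
   element to an element of N_0 and N_1, hence is zero. *)
Definition Der (k : nat) : set (N -> N) :=
  [set D0 \+ D1 | D0 in homogeneous_derivation k false
                & D1 in homogeneous_derivation k true].

Definition ad (k : nat) (x : 'I_n.-1 -> N) : N -> N :=
  fun y => bracket N (append_last x (iter k (alpha N) y)).

Definition Inn (k : nat) : set (N -> N) :=
  lspan [set ad k x | x in
    [set x | forall i, homogeneous (x i) /\ alpha N (x i) = x i]].

Definition positional_center (i : 'I_n) : set N :=
  [set z | forall x : 'I_n -> N, bracket N (replace x i z) = 0].

Definition center : set N := \bigcap_(i in [set: 'I_n]) positional_center i.

Definition complete : Prop :=
  center = [set 0] /\ forall k : nat, Der k.+1 = Inn k.

End HomNambuSuperalgebra.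

Arguments homogeneous_derivation {K n} N k d.
Arguments positional_center {K n} N i.
Arguments Der {K n} N k.
Arguments Inn {K n} N k.
Arguments center {K n} N.
Arguments complete {K n} N.

(* Main.v *)
Require Import Defs.
From mathcomp Require Import all_boot all_order all_algebra.
From mathcomp Require Import boolp classical_sets functions.
Set Implicit Arguments.
Unset Strict Implicit.
Unset Printing Implicit Defensive.
Import GRing.Theory.
Local Open Scope classical_set_scope.
Local Open Scope ring_scope.

(** When the twisting map vanishes and there are at least two slots, the
    right-hand side of the derivation rule for positive powers of [alpha] has
    in each term a slot filled with [0]; hence such a derivation kills every
    bracket of homogeneous elements.  Surjectivity of the bracket then makes it
    zero, but only after a reduction: a vector is the bracket of a family that
    need not be homogeneous, so one expands that family into homogeneous parts
    by multilinearity ([multilinear_homogeneous_eq0]).  The inner derivations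
    vanish because the only fixed point of [alpha = 0] is [0], so each of them
    is a bracket with a zero slot.  Both spaces are therefore the zero space,
    and completeness reduces to the condition on the center. *)

Lemma linear_0 (K : fieldType) (V W : lmodType K) (f : V -> W) :
  linear f -> f 0 = 0.
Proof. by move=> fL; have := fL (-1) 0 0; rewrite scaler0 addr0 scaleN1r addNr. Qed.

Lemma replace_id (T : Type) (n : nat) (x : 'I_n -> T) (i : 'I_n) :
  replace x i (x i) = x.
Proof. by apply: funext => j; rewrite /replace; case: dfwithP. Qed.

Lemma multilinear_eq0 (K : fieldType) (V W : lmodType K) (n : nat)
    (f : ('I_n -> V) -> W) (x : 'I_n -> V) (i : 'I_n) :
  multilinear f -> x i = 0 -> f x = 0.
Proof. by move=> fM xi0; rewrite -(replace_id x i) xi0 (linear_0 (fM x i)). Qed.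

(** The homogeneous vectors span, so a multilinear map is determined by its
    values on homogeneous families.  The induction makes one more slot
    arbitrary at each step, splitting it into its even and odd parts. *)
Lemma multilinear_homogeneous_eq0 (K : fieldType) (n : nat)
    (N : homNambuSuperalgebra K n) (W : lmodType K) (f : ('I_n -> N) -> W) :
  multilinear f ->
  (forall x : 'I_n -> N, (forall i, homogeneous (x i)) -> f x = 0) ->
  forall x, f x = 0.
Proof.
move=> fM f0 x.
suff H m : forall y : 'I_n -> N,
    (forall i : 'I_n, (m <= i)%N -> homogeneous (y i)) -> f y = 0.
  by apply: (H n) => i; rewrite leqNgt ltn_ord.
elim: m => [|m IHm] y yh; first by apply: f0 => i; exact: yh.
have [ltmn|lenm] := ltnP m n; last first.
  by apply: IHm => i /(leq_trans lenm); rewrite leqNgt ltn_ord.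
pose i := Ordinal ltmn.
have part0 p z : z \in grade N p -> f (replace y i z) = 0.
  move=> zp; apply: IHm => j; rewrite /replace.
  case: dfwithP => [_|j' ij lemj]; first by exists p.
  by apply: yh; rewrite ltn_neqAle lemj andbT; apply: contra ij => /eqP mj;
    apply/eqP/val_inj.
have [z0 [z1 [z0h z1h yi]]] := grade_span (y i).
by rewrite -(replace_id y i) yi -[z0]scale1r fM !(part0 _ _ z0h, part0 _ _ z1h)
  scaler0 addr0.
Qed.

Lemma bracket_eq0 (K : fieldType) (n : nat) (N : homNambuSuperalgebra K n)
    (x : 'I_n -> N) (i : 'I_n) : x i = 0 -> bracket N x = 0.
Proof. exact: multilinear_eq0 (@bracket_multilinear _ _ N). Qed.

Lemma derivation_0 (K : fieldType) (n : nat) (N : homNambuSuperalgebra K n)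
    (k : nat) (d : bool) : homogeneous_derivation N k d (fun=> 0).
Proof.
split=> [a u v|p z _||p x _]; first by rewrite scaler0 addr0.
- exact: (grade_submod N (d (+) p)).1.
- by apply: funext => z /=; rewrite raddf0.
- rewrite big1 // => i _.
  by rewrite (bracket_eq0 (i := i)) ?scaler0 // /replace dfwith_in.
Qed.

Lemma exists_neq_ord (n : nat) (i : 'I_n) :
  (2 <= n)%N -> exists j : 'I_n, i != j.
Proof.
move=> n2; have n1 : (1 < #|'I_n|)%N by rewrite card_ord.
have : (0 < #|predC1 i|)%N by rewrite cardC1 -ltnS prednK // ltnW.
by case/card_gt0P => j; rewrite inE eq_sym; exists j.
Qed.

Lemma derivation_alpha0_eq0 (K : fieldType) (n : nat)
    (N : homNambuSuperalgebra K n) (k : nat) (d : bool) (D : N -> N) :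
  (2 <= n)%N -> (forall z : N, alpha N z = 0) ->
  (forall z : N, exists x : 'I_n -> N, bracket N x = z) ->
  homogeneous_derivation N k.+1 d D -> forall z, D z = 0.
Proof.
move=> n2 alpha0 surj [DL _ _ DB] z; have [x <-] := surj z.
apply: (multilinear_homogeneous_eq0 (f := D \o bracket N)) => {x z}.
  by move=> x i a u v; rewrite /= bracket_multilinear DL.
move=> x /choice[p xp] /=; rewrite (DB p x xp) big1 // => i _.
(* Any slot [j] other than [i] contains [alpha^(k+1) (x j) = 0]. *)
have [j ij] := exists_neq_ord i n2.
by rewrite (bracket_eq0 (i := j)) ?scaler0 // /replace dfwith_out //= alpha0.
Qed.

Lemma Der_alpha0 (K : fieldType) (n : nat) (N : homNambuSuperalgebra K n)
    (k : nat) :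
  (2 <= n)%N -> (forall z : N, alpha N z = 0) ->
  (forall z : N, exists x : 'I_n -> N, bracket N x = z) ->
  Der N k.+1 = [set 0].
Proof.
move=> n2 alpha0 surj; apply/seteqP; split=> [_ [D0 D0d [D1 D1d <-]]|_ ->] /=.
  apply: funext => z /=.
  by rewrite !(derivation_alpha0_eq0 n2 alpha0 surj D0d,
               derivation_alpha0_eq0 n2 alpha0 surj D1d) addr0.
exists (fun=> 0); first exact: derivation_0.
exists (fun=> 0); first exact: derivation_0.
by apply: funext => z /=; rewrite addr0.
Qed.

Lemma lspan_eq0 (K : fieldType) (V : lmodType K) (S : set V) :
  S `<=` [set 0] -> lspan S = [set 0].
Proof.
move=> S0; apply/seteqP; split=> [_ [m [c [s [sS ->]]]]|_ ->] /=.
  by rewrite big1 // => i _; rewrite (S0 _ (sS i)) scaler0.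
by exists 0%N, (fun=> 0), (fun=> 0); split; [case|rewrite big_ord0].
Qed.

Lemma Inn_alpha0 (K : fieldType) (n : nat) (N : homNambuSuperalgebra K n)
    (k : nat) :
  (2 <= n)%N -> (forall z : N, alpha N z = 0) -> Inn N k = [set 0].
Proof.
move=> n2 alpha0; apply: lspan_eq0 => _ [x xfix <-] /=.
apply: funext => y; rewrite /ad.
(* As [n >= 2], slot [0] of the bracket is an entry of [x], not [y]. *)
have n1 : (0 < n.-1)%N by rewrite -subn1 subn_gt0.
apply: (bracket_eq0 (i := Ordinal (ltnW n2))).
by rewrite /append_last insubT /= -(xfix _).2 alpha0.
Qed.

Unset Implicit Arguments.
Set Strict Implicit.

Theorem proposition3p12 (K : fieldType) (n : nat)
    (N : homNambuSuperalgebra K n) :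
  [pchar K] =i pred0 -> (2 <= n)%N ->
  (forall z : N, alpha N z = 0) ->
  (forall z : N, exists x : 'I_n -> N, bracket N x = z) ->
  (forall k : nat, Der N k.+1 = Inn N k /\ Inn N k = [set 0]) /\
  (complete N <-> center N = [set 0]).
Proof.
move=> _ n2 alpha0 surj.
have DerInn k : Der N k.+1 = Inn N k by rewrite Der_alpha0 // Inn_alpha0.
split=> [k|]; first by rewrite DerInn Inn_alpha0.
by split=> [[]|].
Qed.
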